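(* For every integer $n\ge 4$, the disjunctive domination number of the torus grid graph $C_4\Box C_n$ is $$\gamma_2^d(C_4\Box C_n)=\begin{cases}\dfrac{n}{2}+1, & n\equiv 2\pmod 4,\\[2mm] \left\lceil \dfrac{n}{2}\right\rceil, & \text{otherwise}.\end{cases}$$
   Context: $C_k$ denotes the cycle on $k$ vertices, and $G\Box H$ is the Cartesian product: vertex set $V(G)\times V(H)$, with $(g,h)\sim(g',h')$ iff either $g=g'$ and $hh'\in E(H)$, or $h=h'$ and $gg'\in E(G)$. For a simple graph $\Gamma$ and a vertex $v$, let $\Gamma(v)$ be the set of vertices at distance $1$ from $v$ and $\Gamma_2(v)$ the set of vertices at distance exactly $2$ from $v$. A set $S\subseteq V(\Gamma)$ is a disjunctive dominating set if every vertex $v\notin S$ satisfies $|\Gamma(v)\cap S|\ge 1$ or $|\Gamma_2(v)\cap S|\ge 2$. The disjunctive domination number $\gamma_2^d(\Gamma)$ is the minimum cardinality of a disjunctive dominating set of $\Gamma$. *)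

(* Defs.v *)
From mathcomp Require Import all_boot.
Set Implicit Arguments. Unset Strict Implicit. Unset Printing Implicit Defensive.

Definition cycle_adj (k : nat) : rel 'I_k :=
  fun i j => (i != j) && ((j == (i.+1 %% k) :> nat) || (i == (j.+1 %% k) :> nat)).

Definition cart_adj (T U : finType) (eG : rel T) (eH : rel U) : rel (T * U) :=
  fun x y => ((x.1 == y.1) && eH x.2 y.2) || ((x.2 == y.2) && eG x.1 y.1).

Definition nbhd (T : finType) (e : rel T) (v : T) : {set T} :=
  [set u | e v u].

(* Gamma_2(v): vertices at distance exactly 2 from v (in a simple graph:
   distinct from v, not adjacent to v, with a common neighbour) *)
Definition nbhd2 (T : finType) (e : rel T) (v : T) : {set T} :=
  [set u | (u != v) && ~~ e v u && [exists w, e v w && e w u]].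

Definition disj_dominating (T : finType) (e : rel T) (S : {set T}) : bool :=
  [forall v, (v \notin S) ==>
     ((0 < #|nbhd e v :&: S|) || (2 <= #|nbhd2 e v :&: S|))].

Definition gamma2d (T : finType) (e : rel T) : nat :=
  \big[minn/#|T|]_(S : {set T} | disj_dominating e S) #|S|.

Arguments cycle_adj : clear implicits.
Definition C4xCn (n : nat) : rel ('I_4 * 'I_n) :=
  cart_adj (cycle_adj 4) (cycle_adj n).
Arguments C4xCn n : clear implicits.

(* Main.v *)
Require Import Defs.
From mathcomp Require Import all_boot.
From mathcomp Require Import zify.

Arguments ordS {n}.
Arguments ord_pred {n}.

(** Let [a j] be the number of vertices of a disjunctive dominating set [S] in
    column [j] (a copy of C_4).  Summing the domination condition over an empty
    column gives [4 (a (j-1) + a (j+1)) + a (j-2) + a (j+2) >= 8].  Give every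
    column charge [4 (a j)] and let it send [min (a j) 2] to each adjacent
    column and [1], if [a j >= 2], to each column at distance 2; then every
    column ends up with charge at least 2, whence [4 |S| >= 2 n].  If equality
    holds, columns with one and with zero vertices alternate, and the row moves
    by 2 from one nonempty column to the next; closing up around the torus
    forces 4 to divide [n].  This tight pattern, with one additional vertex
    when [n = 2 mod 4], also gives the upper bound. *)

(** * Minima, counting and sums over finite types *)

Lemma leq_bigmin (I : eqType) (r : seq I) (P : pred I) (F : I -> nat) x0 m :
  m <= x0 -> (forall i, P i -> m <= F i) ->
  m <= \big[minn/x0]_(i <- r | P i) F i.
Proof.
move=> m0 mF; apply: (big_ind (fun k => m <= k)) => // x y mx my.
by rewrite leq_min mx.
Qed.

Lemma bigmin_leq (I : eqType) (r : seq I) (P : pred I) (F : I -> nat) x0 i :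
  i \in r -> P i -> \big[minn/x0]_(i <- r | P i) F i <= F i.
Proof.
elim: r => // k r IH; rewrite inE big_cons => /orP[/eqP <- -> | ir Pi].
  exact: geq_minl.
by case: ifP => _; rewrite ?geq_min IH ?orbT.
Qed.

(** Repetitions in [l] are harmless for an upper bound, so listed vertices that coincide, as in
    columns [j + 2] and [j - 2] for [n = 4], need no separate treatment. *)
Lemma card_setI_count (T : finType) (A S : {set T}) (l : seq T) :
  {subset A <= l} -> #|A :&: S| <= count (mem S) l.
Proof.
move=> Al; rewrite -size_filter; apply: leq_trans (card_size _).
apply/subset_leq_card/subsetP => x; rewrite inE mem_filter => /andP[/Al -> xS].
by rewrite andbT.
Qed.

Lemma eq_from_leq_sum (I : finType) (f g : I -> nat) :
  (forall i, f i <= g i) -> \sum_i g i <= \sum_i f i -> forall i, f i = g i.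
Proof.
move=> fg gf i.
have [le_fg eq_fg] := leqif_sum (fun i (_ : true) => leqif_eq (fg i)).
have : \sum_i f i == \sum_i g i by rewrite eqn_leq le_fg gf.
by rewrite eq_fg => /forallP/(_ i)/eqP.
Qed.

(** * Cyclic shifts and neighbourhoods in the torus *)

Lemma val_iter_ordS n k (i : 'I_n) : val (iter k ordS i) = (i + k) %% n.
Proof.
elim: k => [|k IH] /=; first by rewrite addn0 modn_small.
by rewrite IH -addn1 modnDml -addnA addn1.
Qed.

Lemma iter_ordS_id n (i : 'I_n) : iter n ordS i = i.
Proof. by apply: val_inj; rewrite val_iter_ordS modnDr modn_small. Qed.

Lemma ord_pred2_4 (i : 'I_4) : ord_pred (ord_pred i) = ordS (ordS i).
Proof. by apply/eqP; case: i => [[|[|[|[|]]]]]. Qed.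

Lemma cycle_adjP n (i j : 'I_n) :
  cycle_adj n i j -> j = ordS i \/ j = ord_pred i.
Proof.
case/andP=> _ /orP[/eqP ij | /eqP ij]; [left | right]; first exact: val_inj.
by rewrite (_ : i = ordS j) ?ordSK //; apply: val_inj.
Qed.

Lemma C4xCnP n (i : 'I_4) (j : 'I_n) u : C4xCn n (i, j) u ->
  u \in [:: (i, ordS j); (i, ord_pred j); (ordS i, j); (ord_pred i, j)].
Proof.
case: u => i' j' /orP[] /andP[/= /eqP <- /cycle_adjP[] ->];
  by rewrite !inE eqxx ?orbT.
Qed.

(** Rows [i + 2] and [i - 2] coincide in C_4, hence seven candidates rather than eight. *)
Lemma C4xCn_nbhd2P n (i : 'I_4) (j : 'I_n) u : u \in nbhd2 (C4xCn n) (i, j) ->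
  u \in [:: (ordS i, ordS j); (ordS i, ord_pred j);
            (ord_pred i, ordS j); (ord_pred i, ord_pred j);
            (i, ordS (ordS j)); (i, ord_pred (ord_pred j)); (ordS (ordS i), j)].
Proof.
rewrite inE -andbA => /and3P[uv _ /existsP[w /andP[/C4xCnP]]].
rewrite !inE => /or4P[] /eqP -> /C4xCnP; rewrite !inE ?ordSK ?ord_predK ?ord_pred2_4;
  by case/or4P => h; move: uv; rewrite h ?orbT.
Qed.

(** * Lower bound by discharging between columns *)

Section LowerBound.
Context (n : nat) (S : {set 'I_4 * 'I_n}).
Hypothesis domS : disj_dominating (C4xCn n) S.

Let s (i : 'I_4) (j : 'I_n) : nat := (i, j) \in S.
Let a (j : 'I_n) : nat := \sum_i s i j.

(** Weight 2 for a neighbour and 1 for a vertex at distance two turns both alternatives of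
    domination into one linear inequality. *)
Lemma domination_weight i j : s i j = 0 ->
  2 <= 2 * (s i (ordS j) + s i (ord_pred j) + s (ordS i) j + s (ord_pred i) j)
    + (s (ordS i) (ordS j) + s (ordS i) (ord_pred j)
       + s (ord_pred i) (ordS j) + s (ord_pred i) (ord_pred j)
       + s i (ordS (ordS j)) + s i (ord_pred (ord_pred j)) + s (ordS (ordS i)) j).
Proof.
move=> sij; have vS : (i, j) \notin S by rewrite -eqb0; apply/eqP.
have /forallP/(_ (i, j))/implyP/(_ vS)/orP[dom1 | dom2] := domS.
  have nb : {subset nbhd (C4xCn n) (i, j) <=
    [:: (i, ordS j); (i, ord_pred j); (ordS i, j); (ord_pred i, j)]}.
    by move=> u; rewrite inE => /C4xCnP.
  apply: leq_trans (leq_addr _ _); rewrite -[leqLHS]muln1 leq_pmul2l //.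
  apply: leq_trans (leq_trans dom1 (card_setI_count _ _ S _ nb)) _.
  by rewrite /= !addnA addn0.
have nb2 u := @C4xCn_nbhd2P n i j u.
apply: leq_trans (leq_addl _ _).
apply: leq_trans (leq_trans dom2 (card_setI_count _ _ S _ nb2)) _.
by rewrite /= !addnA addn0.
Qed.

Lemma sum_column i j :
  a j = s i j + s (ordS i) j + s (ordS (ordS i)) j + s (ord_pred i) j.
Proof.
rewrite /a 4!big_ord_recl big_ord0.
set i0 := ord0; set i1 := lift _ _; set i2 := lift _ _; set i3 := lift _ _.
have S0 : ordS i0 = i1 by apply: val_inj.
have S1 : ordS i1 = i2 by apply: val_inj.
have S2 : ordS i2 = i3 by apply: val_inj.
have S3 : ordS i3 = i0 by apply: val_inj.
have P0 : ord_pred i0 = i3 by apply: val_inj.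
have P1 : ord_pred i1 = i0 by apply: val_inj.
have P2 : ord_pred i2 = i1 by apply: val_inj.
have P3 : ord_pred i3 = i2 by apply: val_inj.
have : [\/ i = i0, i = i1, i = i2 | i = i3].
  by case: i => [[|[|[|[|//]]]] hi];
    [constructor 1 | constructor 2 | constructor 3 | constructor 4]; apply: val_inj.
by case=> ->; rewrite ?(S0, S1, S2, S3, P0, P1, P2, P3); lia.
Qed.

Lemma sum_rowS j : \sum_i s (ordS i) j = a j.
Proof. by rewrite /a [RHS](reindex _ (onW_bij _ (@ordS_bij 4))). Qed.

Lemma sum_row_pred j : \sum_i s (ord_pred i) j = a j.
Proof. by rewrite /a [RHS](reindex _ (onW_bij _ (@ord_pred_bij 4))). Qed.

Lemma column_le4 j : a j <= 4.
Proof.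
rewrite (sum_column ord0) /s.
by do 4 case: (_ \in S).
Qed.

(** Row shifts preserve column sums, so summing the weights over the rows counts each adjacent
    column 2 + 1 + 1 = 4 times. *)
Lemma empty_column j : a j = 0 ->
  8 <= 4 * (a (ordS j) + a (ord_pred j))
       + a (ordS (ordS j)) + a (ord_pred (ord_pred j)).
Proof.
move=> aj0; have s0 i : s i j = 0 by have := sum_column i j; lia.
have : \sum_(i < 4) 2 <= \sum_i
  (2 * s i (ordS j) + 2 * s i (ord_pred j)
    + s (ordS i) (ordS j) + s (ordS i) (ord_pred j)
    + s (ord_pred i) (ordS j) + s (ord_pred i) (ord_pred j)
    + s i (ordS (ordS j)) + s i (ord_pred (ord_pred j))).
  apply: leq_sum => i _; have := domination_weight i j (s0 i).
  by rewrite !s0; lia.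
rewrite sum_nat_const card_ord !big_split /= !big1_eq.
by rewrite !sum_rowS !sum_row_pred -!/(a _); lia.
Qed.

(** Outgoing charge stands on the left. A nonempty column retains 2 by itself. For an empty one,
    either the adjacent columns total at least 2, or they total 1 and some column at distance 2 has
    at least 2, or they are empty and both columns at distance 2 have 4. *)
Lemma discharge j :
  2 + 2 * minn (a j) 2 + 2 * (1 < a j) <=
  4 * a j + minn (a (ordS j)) 2 + minn (a (ord_pred j)) 2
    + (1 < a (ordS (ordS j))) + (1 < a (ord_pred (ord_pred j))).
Proof.
have := empty_column j; have := column_le4 (ordS (ordS j)).
have := column_le4 (ord_pred (ord_pred j)).
by lia.
Qed.

Lemma card_columns : #|S| = \sum_j a j.
Proof.
rewrite -sum1_card big_mkcond /a exchange_big pair_bigA /=.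
by apply: eq_bigr => -[i j] _; rewrite /s; case: (_ \in S).
Qed.

Let sum_colS (f : 'I_n -> nat) : \sum_j f (ordS j) = \sum_j f j.
Proof. by rewrite [RHS](reindex _ (onW_bij _ (@ordS_bij n))). Qed.

Let sum_col_pred (f : 'I_n -> nat) : \sum_j f (ord_pred j) = \sum_j f j.
Proof. by rewrite [RHS](reindex _ (onW_bij _ (@ord_pred_bij n))). Qed.

(** Charge is conserved because shifts permute the columns; the terms are arranged to avoid
    subtraction. *)
Lemma sum_discharge :
  \sum_j (2 + 2 * minn (a j) 2 + 2 * (1 < a j)) + 4 * #|S| =
  \sum_j (4 * a j + minn (a (ordS j)) 2 + minn (a (ord_pred j)) 2
    + (1 < a (ordS (ordS j))) + (1 < a (ord_pred (ord_pred j)))) + 2 * n.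
Proof.
rewrite !big_split /= !big1_eq sum_nat_const card_ord card_columns.
rewrite (sum_colS (fun j => minn (a j) 2)) (sum_col_pred (fun j => minn (a j) 2)).
rewrite (sum_colS (fun j => nat_of_bool (1 < a (ordS j)))).
rewrite (sum_colS (fun j => nat_of_bool (1 < a j))).
rewrite (sum_col_pred (fun j => nat_of_bool (1 < a (ord_pred j)))).
rewrite (sum_col_pred (fun j => nat_of_bool (1 < a j))).
set A := \sum_j a j; set G := \sum_j minn _ _; set H := \sum_j nat_of_bool _.
by lia.
Qed.

Lemma disj_dominating_ge : n <= 2 * #|S|.
Proof.
have := sum_discharge.
have := @leq_sum _ (index_enum _) xpredT _ _ (fun j _ => discharge j).
by lia.
Qed.

(** * The case of equality *)

Section Tight.
Hypothesis tight : 2 * #|S| = n.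

Lemma discharge_eq j :
  2 + 2 * minn (a j) 2 + 2 * (1 < a j) =
  4 * a j + minn (a (ordS j)) 2 + minn (a (ord_pred j)) 2
    + (1 < a (ordS (ordS j))) + (1 < a (ord_pred (ord_pred j))).
Proof.
apply: (eq_from_leq_sum _ _ _ discharge) => {j}.
by have := sum_discharge; lia.
Qed.

(** A nonempty column retains 2 from its own charge, so equality lets it receive nothing. *)
Lemma tight_column_nbr j : 0 < a j -> a (ordS j) = 0 /\ a (ord_pred j) = 0.
Proof. by have := discharge_eq j; lia. Qed.

Lemma tight_column_le1 j : a j <= 1.
Proof.
rewrite leqNgt; apply/negP => aj.
have [a1 _] := tight_column_nbr j (ltnW aj).
have aj2 : a j <= 2 by have := discharge_eq j; lia.
(* Column [j] alone sends 2 to the empty column [j + 1], which thus receives nothing else. *)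
have a2 : a (ordS (ordS j)) = 0.
  by have := discharge_eq (ordS j); rewrite a1 !ordSK; lia.
have a3 : a (ordS (ordS (ordS j))) <= 1.
  by have := discharge_eq (ordS j); rewrite a1 a2 !ordSK; lia.
have a4 := column_le4 (ordS (ordS (ordS (ordS j)))).
(* The empty column [j + 2] needs 8 but gets at most 6: 2 from column [j], and 4 from either column
   [j + 3] or column [j + 4], not both. *)
have := empty_column _ a2; rewrite !ordSK a1.
have := tight_column_nbr (ordS (ordS (ordS j))).
by lia.
Qed.

(** The empty column [j + 1] gets one unit from column [j]; no column exceeds 1, so the second unit
    comes from column [j + 2]. *)
Lemma tight_column_next j : a j = 1 -> a (ordS (ordS j)) = 1.
Proof.
move=> aj; have [a1 _] := tight_column_nbr j (eq_leq (esym aj)).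
have := discharge_eq (ordS j); rewrite !ordSK a1 aj.
have := tight_column_le1 (ordS (ordS j)).
have := tight_column_le1 (ordS (ordS (ordS j))).
have := tight_column_le1 (ord_pred j).
by lia.
Qed.

Lemma tight_step i j : s i j = 1 ->
  s (ordS (ordS i)) (ordS (ordS j)) = 1 /\ s (ordS (ordS i)) j = 0.
Proof.
move=> sij.
have colj := sum_column i j.
have aj : a j = 1 by have := tight_column_le1 j; lia.
have aj2 := tight_column_next j aj.
have empty k : a k = 0 -> forall i', s i' k = 0.
  by move=> ak i'; have := sum_column i' k; lia.
have [/empty s1 /empty sp] := tight_column_nbr j (eq_leq (esym aj)).
have [/empty s3 _] := tight_column_nbr _ (eq_leq (esym aj2)).
(* At [(i + 2, j + 1)] only column [j + 2] contributes, and its single vertex has weight 2 only in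
   row [i + 2]. *)
have := domination_weight _ _ (s1 (ordS (ordS i))).
rewrite !ordSK !s1 sp s3 (_ : ordS (ordS (ordS i)) = ord_pred i); last first.
  by rewrite -(ord_pred2_4 i) ord_predK.
by have := sum_column i (ordS (ordS j)); lia.
Qed.

Lemma tight_mod4 : n %% 4 != 2.
Proof.
apply/eqP => n2.
have [[i j] ijS] : exists x, x \in S by apply/card_gt0P; lia.
have sij : s i j = 1 by rewrite /s ijS.
have walk k : s (iter (k * 2) ordS i) (iter (k * 2) ordS j) = 1.
  by elim: k => // k /tight_step[].
(* After [#|S|] double steps, that is [n] columns, the walk is back in column [j] but in row
   [i + 2]. *)
have := walk #|S|; rewrite mulnC tight iter_ordS_id.
rewrite (_ : iter n ordS i = ordS (ordS i)); last first.
  apply: val_inj; rewrite val_iter_ordS -[ordS (ordS i)]/(iter 2 ordS i).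
  by rewrite val_iter_ordS -modnDmr n2.
by have [_ ->] := tight_step i j sij.
Qed.

End Tight.

End LowerBound.

(** * Exhibiting vertices at distance one and two *)

Lemma disj_dominatingP (T : finType) (e : rel T) (S : {set T}) :
  (forall v, v \notin S ->
     (exists2 u, u \in S & e v u) \/
     exists x y, [/\ x != y, x \in S, y \in S, x \in nbhd2 e v & y \in nbhd2 e v]) ->
  disj_dominating e S.
Proof.
move=> H; apply/forallP => v; apply/implyP => /H[[u uS vu] | [x [y [xy xS yS xv yv]]]].
  by apply/orP; left; apply/card_gt0P; exists u; rewrite !inE vu.
apply/orP; right; have <- : #|[set x; y]| = 2 by rewrite cards2 xy.
by apply/subset_leq_card/subsetP => z /set2P[] ->; rewrite inE ?xv ?yv.
Qed.

Lemma cycle_adj_sym n : symmetric (cycle_adj n).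
Proof. by move=> i j; rewrite /cycle_adj eq_sym orbC. Qed.

Lemma cycle_adjS n (i j : 'I_n) : j = i.+1 :> nat -> cycle_adj n i j.
Proof.
move=> ij; rewrite /cycle_adj -val_eqE /= ij modn_small -?ij //.
by rewrite eqxx /= andbT ij; lia.
Qed.

Lemma cycle_adj_wrap n (i j : 'I_n) :
  1 < n -> i = n.-1 :> nat -> j = 0 :> nat -> cycle_adj n i j.
Proof.
move=> n1 iE jE; rewrite /cycle_adj -val_eqE /= iE jE prednK ?modnn; lia.
Qed.

Lemma C4xCn_row n (i i' : 'I_4) (j : 'I_n) :
  cycle_adj 4 i i' -> C4xCn n (i, j) (i', j).
Proof. by move=> ii; rewrite /C4xCn /cart_adj /= ii eqxx orbT. Qed.

Lemma C4xCn_col n (i : 'I_4) (j j' : 'I_n) :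
  cycle_adj n j j' -> C4xCn n (i, j) (i, j').
Proof. by move=> jj; rewrite /C4xCn /cart_adj /= jj eqxx. Qed.

Lemma nbhd2_diag n (i i' : 'I_4) (j j' : 'I_n) :
  cycle_adj 4 i i' -> cycle_adj n j j' -> (i', j') \in nbhd2 (C4xCn n) (i, j).
Proof.
move=> ii jj; have /andP[ni _] := ii; have /andP[nj _] := jj.
rewrite inE /C4xCn /cart_adj /= xpair_eqE -(eq_sym i) (negPf ni) (negPf nj) /=.
by apply/existsP; exists (i', j); rewrite /= ii jj !eqxx !orbT.
Qed.

Lemma nbhd2_row n (i i' : 'I_4) (j : 'I_n) :
  i' = (i + 2) %% 4 :> nat -> (i', j) \in nbhd2 (C4xCn n) (i, j).
Proof.
move=> ii; have [ni na] : i' != i /\ ~~ cycle_adj 4 i i'.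
  by move: i i' ii => [[|[|[|[|//]]]] hi] [[|[|[|[|//]]]] hi'].
have mid : cycle_adj 4 i (ordS i) && cycle_adj 4 (ordS i) i'.
  by move: i i' ii {ni na} => [[|[|[|[|//]]]] hi] [[|[|[|[|//]]]] hi'].
have nc : cycle_adj n j j = false by rewrite /cycle_adj eqxx.
rewrite inE /C4xCn /cart_adj /= xpair_eqE eqxx (negPf ni) (negPf na) nc /= andbF /=.
by apply/existsP; exists (ordS i, j); have /andP[-> ->] := mid; rewrite /= eqxx !orbT.
Qed.

(** The bound on [n] rules out a wraparound edge, as in a triangle; the common neighbour lies in
    column [minn j j' + 1]. *)
Lemma nbhd2_col n (i : 'I_4) (j j' : 'I_n) : 4 <= n ->
  (j' = j + 2 :> nat) \/ (j = j' + 2 :> nat) -> (i, j') \in nbhd2 (C4xCn n) (i, j).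
Proof.
move=> n4 jj.
have lt : (minn j j').+1 < n by case: jj; have := ltn_ord j; have := ltn_ord j'; lia.
have nj : j' != j by rewrite -val_eqE /=; lia.
have na : ~~ cycle_adj n j j'.
  have modS (k : 'I_n) : k.+1 %% n = if k.+1 == n then 0 else k.+1.
    case: eqP => [-> | ne]; first by rewrite modnn.
    by rewrite modn_small //; have := ltn_ord k; lia.
  rewrite /cycle_adj !modS negb_and negb_or; apply/orP; right.
  by case: ifP; case: ifP; lia.
have ni : cycle_adj 4 i i = false by rewrite /cycle_adj eqxx.
rewrite inE /C4xCn /cart_adj /= xpair_eqE eqxx (negPf nj) (negPf na) ni /= andbF /=.
apply/existsP; exists (i, Ordinal lt); rewrite /= eqxx.
by case: jj => jj; apply/andP; split; apply/orP; left;
  do ?[apply: cycle_adjS => /=; lia | rewrite cycle_adj_sym].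
Qed.

(** * The extremal set and its domination property *)

(** Even columns alternate between rows 0 and 2. If [n = 2] mod 4, columns [n - 2] and 0 both use
    row 0, and the extra vertex in the last column repairs this clash. *)
Definition zigzag (n : nat) : {set 'I_4 * 'I_n} :=
  [set x : 'I_4 * 'I_n | (~~ odd x.2) && (x.1 == x.2 %% 4 :> nat)
     || [&& n %% 4 == 2, x.1 == 2 :> nat & x.2 == n.-1 :> nat]].

Lemma card_zigzag n : 4 <= n ->
  #|zigzag n| <= if n %% 4 == 2 then n %/ 2 + 1 else (n + 1) %/ 2.
Proof.
case: n => // n n4.
(* [f k] is the regular vertex of column [2k]; [E] holds the extra vertex, if any. *)
pose f (k : 'I_((n.+1 + 1) %/ 2)) : 'I_4 * 'I_n.+1 := (inord (k * 2 %% 4), inord (k * 2)).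
pose E := [set x : 'I_4 * 'I_n.+1 | (n.+1 %% 4 == 2) && (x == (inord 2, ord_max))].
have sub : zigzag n.+1 \subset (f @: setT) :|: E.
  apply/subsetP => -[i j]; rewrite !inE /= => /orP[/andP[ej /eqP ij]|].
    apply/orP; left; apply/imsetP.
    have lt : j./2 < (n.+1 + 1) %/ 2 by have := ltn_ord j; lia.
    have jE : j./2 * 2 = j by lia.
    exists (Ordinal lt) => //; rewrite /f /= jE.
    by rewrite -ij !inord_val.
  case/and3P=> -> /eqP i2 /eqP jn; apply/orP; right => /=.
  by apply/eqP; congr pair; apply: val_inj; rewrite /= ?inordK.
apply: leq_trans (subset_leq_card sub) _; apply: leq_trans (leq_card_setU _ _) _.
have := leq_imset_card f setT; rewrite cardsT card_ord.
have : #|E| <= (n.+1 %% 4 == 2).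
  case: eqP => n2; last first.
    by rewrite leqn0 cards_eq0; apply/eqP/setP => x; rewrite !inE; case: eqP n2.
  apply: leq_trans (_ : #|[set (inord 2 : 'I_4, @ord_max n)]| <= _);
    last by rewrite cards1.
  by apply/subset_leq_card/subsetP => x; rewrite !inE => /andP[].
move=> cE cI; apply: leq_trans (leq_add cI cE) _.
by case: eqP; lia.
Qed.

Lemma cycle_adj4 (i i' : 'I_4) :
  (odd i != odd i') -> cycle_adj 4 i i'.
Proof. by move: i i' => [[|[|[|[|//]]]] hi] [[|[|[|[|//]]]] hi']. Qed.

Lemma zigzag_dominating n : 4 <= n -> disj_dominating (C4xCn n) (zigzag n).
Proof.
move=> n4; apply: disj_dominatingP => -[i j] vS.
pose r k : 'I_4 := inord (k %% 4).
have rE k : r k = k %% 4 :> nat by rewrite inordK // ltn_mod.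
have DS (k : 'I_n) : ~~ odd k -> (r k, k) \in zigzag n.
  by move=> ek; rewrite inE /= ek rE eqxx.
have rodd k : odd (r k) = odd k by rewrite rE; lia.
have row_cases k : odd i = odd k -> i = r k \/ r k = (i + 2) %% 4 :> nat.
  rewrite rE; have := ltn_ord i => i4 ik.
  case: (eqVneq (i : nat) (k %% 4)) => [e|ne]; last by right; lia.
  by left; apply: val_inj; rewrite /= rE.
(* Column [j] lies between columns whose vertices are in rows 0 and 2: an even row [i] meets one of
   them as a neighbour, an odd row sees both diagonally. *)
have between (k k' : 'I_n) : ~~ odd k -> ~~ odd k' -> k != k' ->
    k' %% 4 = (k + 2) %% 4 -> cycle_adj n j k -> cycle_adj n j k' ->
    (exists2 u, u \in zigzag n & C4xCn n (i, j) u) \/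
    exists x y, [/\ x != y, x \in zigzag n, y \in zigzag n,
      x \in nbhd2 (C4xCn n) (i, j) & y \in nbhd2 (C4xCn n) (i, j)].
  move=> ek ek' kk' k2 jk jk'.
  have [ei | ei] := boolP (odd i).
    right; exists (r k, k), (r k', k').
    by split; rewrite ?DS ?xpair_eqE ?(negPf kk') ?andbF //;
      apply: nbhd2_diag => //; apply: cycle_adj4; rewrite rodd; lia.
  left; have [ik|ik] : i = r k \/ i = r k'.
  - case: (row_cases k); [lia | by left | move=> h; right].
    by apply: val_inj; rewrite /= rE k2; move: h; rewrite rE; have := ltn_ord i; lia.
  - by exists (r k, k); rewrite ?DS // ik; apply: C4xCn_col.
  by exists (r k', k'); rewrite ?DS // ik; apply: C4xCn_col.
have jn := ltn_ord j.
have [oj | ej] := boolP (odd j).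
  have ltp : j.-1 < n by lia.
  have adjp : cycle_adj n j (Ordinal ltp).
    by rewrite cycle_adj_sym; apply: cycle_adjS => /=; lia.
  have [ltS | geS] := ltnP j.+1 n.
    have adjS : cycle_adj n j (Ordinal ltS) by exact: cycle_adjS.
    by apply: (between _ _ _ _ _ _ adjp adjS); rewrite -?val_eqE /=; lia.
  have jE : j = n.-1 :> nat by lia.
  have lt0 : 0 < n by lia.
  (* Here [n] is even; columns [n - 2] and 0 use opposite rows exactly when 4 divides [n]. *)
  have [n2 | n2] := eqVneq (n %% 4) 2; last first.
    have adj0 : cycle_adj n j (Ordinal lt0) by apply: cycle_adj_wrap => //; lia.
    by apply: (between _ _ _ _ _ _ adjp adj0); rewrite -?val_eqE /=; lia.
  have mS : (inord 2 : 'I_4, j) \in zigzag n.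
    by rewrite inE /= n2 jE inordK // !eqxx orbT.
  (* Odd rows are adjacent to the extra vertex; the remaining row 0 is adjacent to the vertex of
     column [n - 2]. *)
  left; have [ei | ei] := boolP (odd i).
    by exists (inord 2, j) => //; apply/C4xCn_row/cycle_adj4; rewrite ei inordK.
  exists (r j.-1, Ordinal ltp); first by rewrite (DS (Ordinal ltp)) //=; lia.
  have -> : r j.-1 = i; last exact: C4xCn_col.
  apply: val_inj; rewrite /= rE.
  have : i != 2 :> nat.
    by apply: contra vS => /eqP i2; rewrite inE /= n2 i2 jE !eqxx orbT.
  by have := ltn_ord i; lia.
have [ei | ei] := boolP (odd i).
  left; exists (r j, j); first exact: DS.
  by apply/C4xCn_row/cycle_adj4; rewrite rodd; lia.
have [ij | ij] : i = r j \/ r j = (i + 2) %% 4 :> nat by apply: row_cases; lia.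
  by move: vS; rewrite ij DS.
(* Besides [(r j, j)], a second vertex at distance two lies in row [i], two columns to the left, or
   to the right if [j = 0], so without wraparound. *)
have [k [ek jk]] : exists k : 'I_n, ~~ odd k /\ (k = j + 2 :> nat \/ j = k + 2 :> nat).
  have [j0 | j0] := posnP j.
    have lt2 : 2 < n by lia.
    by exists (Ordinal lt2); rewrite /= j0; split; [| left].
  have lt2 : j - 2 < n by lia.
  by exists (Ordinal lt2) => /=; split; [| right]; lia.
have ik : i = r k.
  by apply: val_inj; move: ij; rewrite /= !rE; have := ltn_ord i; lia.
right; exists (r j, j), (r k, k); split; rewrite ?DS //.
- by rewrite xpair_eqE negb_and -(val_eqE j) /=; apply/orP; right; lia.
- exact: nbhd2_row.
by rewrite -ik; apply: nbhd2_col.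
Qed.

Theorem theorem3 (n : nat) (hn : 4 <= n) :
  gamma2d (C4xCn n) =
    (if n %% 4 == 2 then n %/ 2 + 1 else (n + 1) %/ 2).
Proof.
apply/eqP; rewrite eqn_leq; apply/andP; split.
  apply: leq_trans (card_zigzag n hn).
  by apply: bigmin_leq (zigzag_dominating n hn); rewrite mem_index_enum.
apply: leq_bigmin => [|S domS].
  (* The default value of the minimum, [4 * n], must satisfy the bound too. *)
  by rewrite card_prod !card_ord; case: ifP; lia.
move: (disj_dominating_ge n S domS) (tight_mod4 n S domS); set c := #|S|.
(* For [n = 2] mod 4, excluding [2 * c = n] raises the bound to [n / 2 + 1]. *)
by case: eqP => n2 le tight; [have : 2 * c <> n by move=> /tight | ]; lia.
Qed.
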